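(* Let $n\ge 3$, $0<p\le\tfrac12$ and $q=1-p$. Then $$M_2(n,p)\;=\;p-pq^{\,n-1}+qp^{\,n-1},$$ and this maximum is attained by the one-flip stars $\mathcal F_a^{*}$, $a\in[n]$. Moreover, for $0<p<\tfrac12$: (i) if $n\ge5$, the maximisers (the non-trivial intersecting families $\mathcal F\subseteq V_n$ with $\mu_p(\mathcal F)=M_2(n,p)$) are exactly the $n$ families $\mathcal F_a^{*}$, $a\in[n]$, and these $n$ families are pairwise distinct; (ii) if $n=4$, there are exactly eight maximisers: the four one-flip stars $\mathcal F_a^{*}$, $a\in[4]$, and the four triangle systems $\mathcal T_B=\binom{B}{2}\cup\binom{[4]}{3}\cup\{[4]\}$, $B\in\binom{[4]}{3}$; (iii) if $n=3$, the unique maximiser is the triangle system $\{\{1,2\},\{1,3\},\{2,3\},\{1,2,3\}\}$, which coincides with $\mathcal F_a^{*}$ for every $a\in[3]$. At $p=\tfrac12$ the value $M_2(n,\tfrac12)$ equals $\tfrac12$, and among non-trivial intersecting families it is attained exactly by the non-trivial maximal intersecting families (that is, by every maximal intersecting family $\mathcal F\subseteq V_n$ with empty kernel, and by no other non-trivial intersecting family).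
   Context: $[n]=\{1,\dots,n\}$; $V_n$ is the set of nonempty subsets of $[n]$; $\binom{X}{k}$ is the set of $k$-element subsets of $X$. A family $\mathcal F\subseteq V_n$ is intersecting if $A\cap B\ne\varnothing$ for all $A,B\in\mathcal F$. Its kernel is $\ker\mathcal F=\bigcap_{S\in\mathcal F}S$, with $\ker\varnothing=[n]$. An intersecting family is non-trivial (equivalently kernel-free, non-condensed) if $\ker\mathcal F=\varnothing$. A maximal intersecting family is an intersecting $\mathcal F\subseteq V_n$ maximal under inclusion among intersecting subfamilies of $V_n$. For $0<p<1$, $q=1-p$, set $\mu_p(\mathcal F)=\sum_{S\in\mathcal F}p^{|S|}q^{\,n-|S|}$, and $M_2(n,p)=\max\{\mu_p(\mathcal F):\mathcal F\subseteq V_n\text{ a non-trivial intersecting family}\}$. Put $\mathrm{Star}(a)=\{S\in V_n:a\in S\}$; the one-flip star at $a\in[n]$ is $\mathcal F_a^{*}=(\mathrm{Star}(a)\setminus\{\{a\}\})\cup\{[n]\setminus\{a\}\}$. *)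

(* Defs.v *)
From mathcomp Require Import all_boot all_order all_algebra.
From mathcomp Require Import reals.
Set Implicit Arguments.
Unset Strict Implicit.
Unset Printing Implicit Defensive.
Import Order.TTheory GRing.Theory Num.Theory.
Local Open Scope ring_scope.

(* The ground set [n] = {1, ..., n} is represented by 'I_n; the ordinal i
   stands for the element i + 1 of [n]. *)

Definition Vn (n : nat) : {set {set 'I_n}} := [set S | S != set0].

(* [labelled n [:: i_1; ...; i_k]] is the subset {i_1, ..., i_k} of [n], with
   the elements numbered from 1. *)
Definition labelled (n : nat) (s : seq nat) : {set 'I_n} :=
  [set i : 'I_n | i.+1 \in s].

Definition ksubsets (n : nat) (X : {set 'I_n}) (k : nat) : {set {set 'I_n}} :=
  [set S : {set 'I_n} | (S \subset X) && (#|S| == k)].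

Definition intersecting (n : nat) (F : {set {set 'I_n}}) : bool :=
  (F \subset Vn n) && [forall A in F, forall B in F, A :&: B != set0].

(* The empty intersection is setT, so ker set0 = [n]. *)
Definition ker (n : nat) (F : {set {set 'I_n}}) : {set 'I_n} :=
  \bigcap_(S in F) S.

Definition nontrivial_intersecting (n : nat) (F : {set {set 'I_n}}) : bool :=
  intersecting F && (ker F == set0).

Definition maximal_intersecting (n : nat) (F : {set {set 'I_n}}) : bool :=
  maxset (@intersecting n) F.

Definition mu (R : realType) (n : nat) (p : R) (F : {set {set 'I_n}}) : R :=
  \sum_(S in F) p ^+ #|S| * (1 - p) ^+ (n - #|S|).

(* As mu is nonnegative for 0 <= p <= 1, the default value 0 does not affect the
   maximum as soon as a non-trivial intersecting family exists (n >= 3). *)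
Definition M2 (R : realType) (n : nat) (p : R) : R :=
  \big[Order.max/0]_(F : {set {set 'I_n}} | nontrivial_intersecting F) mu p F.

Definition maximisers (R : realType) (n : nat) (p : R) :
    {set {set {set 'I_n}}} :=
  [set F | nontrivial_intersecting F && (mu p F == M2 n p)].

Definition Star (n : nat) (a : 'I_n) : {set {set 'I_n}} :=
  [set S in Vn n | a \in S].

Definition one_flip_star (n : nat) (a : 'I_n) : {set {set 'I_n}} :=
  (Star a :\ [set a]) :|: [set [set: 'I_n] :\ a].

(* Meant for n = 4 and #|B| = 3. *)
Definition triangle_system (n : nat) (B : {set 'I_n}) : {set {set 'I_n}} :=
  ksubsets B 2 :|: ksubsets [set: 'I_n] 3 :|: [set [set: 'I_n]].

(* Meant for n = 3. *)
Definition triangle3 (n : nat) : {set {set 'I_n}} :=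
  [set labelled n [:: 1; 2]; labelled n [:: 1; 3];
       labelled n [:: 2; 3]; labelled n [:: 1; 2; 3]]%N.

(* Main.v *)
Require Import Defs.
From mathcomp Require Import all_boot all_order all_algebra.
From mathcomp Require Import reals.
From mathcomp Require Import ring lra zify.
Import Order.TTheory GRing.Theory Num.Theory.
Local Open Scope ring_scope.

(** Sets are coded by bit vectors, and measures are split along the first
    coordinates.  A maximal intersecting family F contains exactly one set of
    each complementary pair, so its trace G on the sets avoiding one point of
    [n] determines it, and mu_p(F) = p - D(G) where
    D(G) = p mu_q(G) - q mu_p(G) is computed on m = n - 1 points.  If F is
    non-trivial, G contains the full set and no singleton, and the claim becomes
    D(G) >= p q^m - q p^m.  Split G into G0 and G1 along a further point, and
    let g be the family of the A in G1 whose complement is not in G1.  Then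
    g is intersecting, contains G0, satisfies
    mu_q(g) - mu_p(g) = mu_q(G1) - mu_p(G1), and
      D(G) = q D(G0) + p D(g) + p (q - p) mu_q(g \ G0),
    whence the bound follows by induction, after distinguishing whether G0 is
    empty and whether g is a star (in which case D(g) = 0).  For m >= 4
    and p < q, equality leaves only G = {full set} and G = a star minus its
    singleton, which are the traces of the one-flip stars. *)

(** * Weighted sums over the Boolean cube *)

(** [a] weighs an absent point and [b] a present one: with q = 1 - p, [cubesum q p] is the measure
    mu_p and [cubesum p q] is mu_q. *)
Fixpoint cubesum {R : nzRingType} (a b : R) (n : nat) (f : pred (seq bool)) : R :=
  if n is m.+1 then
    a * cubesum a b m (fun v => f (false :: v))
    + b * cubesum a b m (fun v => f (true :: v))
  else (f [::])%:R.

Definition upclosed (n : nat) (f : pred (seq bool)) : Prop :=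
  forall u v, size u = n -> size v = n -> all2 implb u v -> f u -> f v.

(* For an upclosed f this says that any two members of f meet. *)
Definition antipode_free (n : nat) (f : pred (seq bool)) : Prop :=
  forall v, size v = n -> f v -> ~~ f (map negb v).

Definition singleton_free (n : nat) (f : pred (seq bool)) : Prop :=
  forall v, size v = n -> f v -> (1 < count id v)%N.

Lemma map_negbK : involutive (map negb).
Proof. exact: mapK negbK. Qed.

Lemma all2_implb_negb u v :
  all2 implb u v -> all2 implb (map negb v) (map negb u).
Proof.
elim: u v => [|a u IH] [|b v] //= /andP[ab /IH ->].
by case: a b ab => [] [].
Qed.

Lemma all2_implb_nseq n v : size v = n -> all2 implb v (nseq n true).
Proof. by elim: n v => [|n IH] [|[] v] //= [/IH->]. Qed.

Lemma count_id_eq0_nseq n v : size v = n -> count id v = 0%N -> v = nseq n false.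
Proof. by elim: n v => [|n IH] [|[] v] //= [sv] /= /(IH _ sv) ->. Qed.

Lemma count1_nth n v : size v = n -> count id v = 1%N ->
  exists2 l, (l < n)%N & nth false v l /\
    forall u, size u = n -> nth false u l -> all2 implb v u.
Proof.
elim: n v => [|n IH] [|[] v] //= [sv]; last first.
  move=> /(IH _ sv)[l ln [vl H]]; exists l.+1 => //; split=> //.
  by case=> [|b u] //= [su] /(H _ su).
case=> /(count_id_eq0_nseq _ _ sv) ->; exists 0%N => //; split=> //.
case=> [|b u] //= [su] -> /=; elim: {IH v sv} n u su => [|n IH] [|c u] //= [].
exact: IH.
Qed.

Section CubeSum.
Variable R : realFieldType.
Implicit Types (a b : R) (f g : pred (seq bool)).

Lemma eq_cubesum a b n f g : (forall v, size v = n -> f v = g v) ->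
  cubesum a b n f = cubesum a b n g.
Proof.
elim: n f g => [|n IH] f g /= fg; first by rewrite fg.
by congr (_ * _ + _ * _); apply: IH => v sv; apply: fg; rewrite /= sv.
Qed.

Lemma cubesum_negb a b n f :
  cubesum a b n (fun v => f (map negb v)) = cubesum b a n f.
Proof.
elim: n f => //= n IH f; rewrite addrC.
by rewrite (IH (fun v => f (true :: v))) (IH (fun v => f (false :: v))).
Qed.

Lemma cubesum_split a b n f g :
  cubesum a b n f = cubesum a b n (fun v => f v && g v)
                    + cubesum a b n (fun v => f v && ~~ g v).
Proof.
elim: n f g => [|n IH] f g /=.
  by case: (f [::]); case: (g [::]); rewrite ?addr0 ?add0r.
rewrite (IH (fun v => f (false :: v)) (fun v => g (false :: v))).
rewrite (IH (fun v => f (true :: v)) (fun v => g (true :: v))).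
ring.
Qed.

Lemma cubesum_pred0 a b n f : (forall v, size v = n -> ~~ f v) ->
  cubesum a b n f = 0.
Proof.
elim: n f => [|n IH] f f0 /=; first by rewrite (negbTE (f0 _ _)).
by rewrite !IH ?mulr0 ?addr0 // => v sv; apply: f0; rewrite /= sv.
Qed.

Lemma cubesum_predT a b n : a + b = 1 -> cubesum a b n predT = 1.
Proof.
by move=> ab; elim: n => //= n; rewrite /predT /= => ->; rewrite !mulr1.
Qed.

Lemma cubesum_predC a b n f : a + b = 1 ->
  cubesum a b n (fun v => ~~ f v) = 1 - cubesum a b n f.
Proof.
move=> ab; have := cubesum_split a b n predT f.
rewrite cubesum_predT // => ->.
by apply/eqP; rewrite eq_sym subr_eq addrC.
Qed.

Lemma cubesum_nth a b n l : a + b = 1 -> (l < n)%N ->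
  cubesum a b n (fun v => nth false v l) = b.
Proof.
move=> ab; elim: n l => [|n IH] [|l] //= ln.
  have /= := cubesum_predT a b n ab; rewrite /predT => ->.
  by rewrite (@cubesum_pred0 _ _ _ (fun=> false)) // mulr0 add0r mulr1.
by rewrite IH // -mulrDl ab mul1r.
Qed.

Lemma cubesum_ge0 a b n f : 0 <= a -> 0 <= b -> 0 <= cubesum a b n f.
Proof.
move=> a0 b0; elim: n f => [|n IH] f /=; first exact: ler0n.
by rewrite addr_ge0 // mulr_ge0.
Qed.

Lemma cubesum_ge_point a b n f v : 0 <= a -> 0 <= b -> size v = n -> f v ->
  a ^+ (n - count id v) * b ^+ count id v <= cubesum a b n f.
Proof.
move=> a0 b0; elim: n f v => [|n IH] f v /=.
  by move=> /size0nil -> ->; rewrite mulr1.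
case: v => [|c v] //= [sv] fv.
have cv : (count id v <= n)%N by rewrite -sv count_size.
case: c fv => /= fv.
  rewrite add1n subSS exprS mulrCA.
  apply: ler_wpDl; first by rewrite mulr_ge0 // cubesum_ge0.
  by rewrite ler_wpM2l // (IH (fun v => f (true :: v))).
rewrite add0n subSn // exprS -mulrA.
apply: ler_wpDr; first by rewrite mulr_ge0 // cubesum_ge0.
by rewrite ler_wpM2l // (IH (fun v => f (false :: v))).
Qed.

(** A second member would add its own positive weight to that of [v]. *)
Lemma cubesum_point_eq a b n f v : 0 < a -> 0 < b -> size v = n -> f v ->
  cubesum a b n f <= a ^+ (n - count id v) * b ^+ count id v ->
  forall u, size u = n -> f u -> u = v.
Proof.
move=> a0 b0 sv fv le u su fu; apply/eqP; apply: contraT => uv.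
have ge1 := @cubesum_ge_point a b n (fun w => f w && (w == v)) v
  (ltW a0) (ltW b0) sv.
have ge2 := @cubesum_ge_point a b n (fun w => f w && (w != v)) u
  (ltW a0) (ltW b0) su.
rewrite /= fv eqxx in ge1; rewrite /= fu uv in ge2.
have pos : 0 < a ^+ (n - count id u) * b ^+ count id u.
  by rewrite mulr_gt0 // exprn_gt0.
have := cubesum_split a b n f (pred1 v).
move: (ge1 isT) (ge2 isT) le pos => /=; lra.
Qed.

End CubeSum.

(** * The inductive inequality *)

Lemma upclosed_cons n f b :
  upclosed n.+1 f -> upclosed n (fun v => f (b :: v)).
Proof.
move=> up u v su sv uv; apply: up; rewrite /= ?su ?sv //.
by rewrite uv; case: b.
Qed.

Lemma upclosed_cons_sub n f v : upclosed n.+1 f -> size v = n ->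
  f (false :: v) -> f (true :: v).
Proof.
move=> up sv; apply: up; rewrite /= ?sv //.
by elim: v {sv} => //= -[].
Qed.

(** For an upclosed [f] these are the members that meet every member of [f], since a member disjoint
    from [v] lies below the complement of [v]. *)
Definition selfmeet (f : pred (seq bool)) : pred (seq bool) :=
  fun v => f v && ~~ f (map negb v).

Lemma upclosed_selfmeet n f : upclosed n f -> upclosed n (selfmeet f).
Proof.
move=> up u v su sv uv /andP[fu nfu]; rewrite /selfmeet (up u v) //=.
apply: contra nfu; apply: up; rewrite ?size_map //.
exact: all2_implb_negb.
Qed.

Lemma antipode_free_selfmeet n f : antipode_free n (selfmeet f).
Proof. by move=> v _ /andP[fv nfv]; rewrite /selfmeet map_negbK negb_and nfv. Qed.

Lemma all2_implb_join n u v : size u = n -> size v = n ->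
  exists w, [/\ size w = n, all2 implb u w, all2 implb v w
    & w = nseq n true -> all2 implb (map negb v) u].
Proof.
elim: n u v => [|n IH] [|a u] [|b v] //=; first by exists [::].
move=> [su] [sv]; have [w [sw uw vw H]] := IH u v su sv.
exists (a || b :: w); rewrite /= sw uw vw; split=> //.
- by case: a.
- by case: a; case: b.
by case=> ab /H ->; case: a b ab => [] [].
Qed.

Section Excess.
Variables (R : realFieldType) (p q : R).
Hypotheses (p_gt0 : 0 < p) (p_le_q : p <= q) (pq1 : p + q = 1).

Let q_gt0 : 0 < q. Proof. exact: lt_le_trans p_gt0 p_le_q. Qed.
Let p_ge0 : 0 <= p. Proof. exact: ltW. Qed.
Let q_ge0 : 0 <= q. Proof. exact: ltW. Qed.
Let qp1 : q + p = 1. Proof. by rewrite addrC. Qed.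
Let q_def : q = 1 - p. Proof. by rewrite -pq1 addrAC subrr add0r. Qed.
Let qp_ge0 : 0 <= q - p. Proof. by rewrite subr_ge0. Qed.
Let p_le1 : p <= 1. Proof. by rewrite -pq1 lerDl. Qed.
Let p_lt1 : p < 1. Proof. by rewrite -pq1 ltrDl. Qed.

(** The quantity D of the overview, to be applied to the trace of a family on the sets avoiding one
    point. *)
Definition excess (n : nat) (f : pred (seq bool)) : R :=
  p * cubesum p q n f - q * cubesum q p n f.

(* The vectors dropped from f come in complementary pairs, so they have the same
   mass for both biases. *)
Lemma cubesum_selfmeet n f :
  cubesum p q n f - cubesum q p n f
  = cubesum p q n (selfmeet f) - cubesum q p n (selfmeet f).
Proof.
have sym : cubesum p q n (fun v => f v && f (map negb v))
         = cubesum q p n (fun v => f v && f (map negb v)).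
  rewrite -cubesum_negb; apply: eq_cubesum => v _.
  by rewrite map_negbK andbC.
rewrite (cubesum_split _ p q n f (fun v => f (map negb v))).
rewrite (cubesum_split _ q p n f (fun v => f (map negb v))) sym /selfmeet.
ring.
Qed.

(** The half of [f] with first bit true contributes only pq times the difference of its two
    measures, which [selfmeet] preserves. Since g contains [f0], the remainder is algebra with p + q
    = 1. *)
Lemma excess_cons n f : upclosed n.+1 f -> antipode_free n.+1 f ->
  let f0 v := f (false :: v) in
  let g := selfmeet (fun v => f (true :: v)) in
  excess n.+1 f = q * excess n f0 + p * excess n g
    + p * (q - p) * cubesum p q n (fun v => g v && ~~ f0 v).
Proof.
move=> up af /=.
set f0 := fun v => f (false :: v); set g := selfmeet _.
have f0g v : size v = n -> f0 v -> g v.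
  move=> sv f0v; rewrite /g /selfmeet (upclosed_cons_sub _ _ _ up) //=.
  by apply: (af (false :: v)); rewrite /= ?sv.
have := cubesum_split _ p q n g f0.
rewrite (eq_cubesum _ p q n (fun v => g v && f0 v) f0); last first.
  by move=> v sv; case: (boolP (f0 v)) => [/(f0g _ sv) ->|]; rewrite ?andbF.
move=> Eg; have := cubesum_selfmeet n (fun v => f (true :: v)).
rewrite -/g /excess /= -/f0 {}Eg.
set Y := cubesum q p n g; set X := cubesum p q n f0.
set Z := cubesum p q n (fun v => _ && _); set X' := cubesum q p n f0.
set A := cubesum p q n _; set B := cubesum q p n _.
move=> /eqP; rewrite subr_eq => /eqP ->.
rewrite q_def; ring.
Qed.

(** By upclosedness every set containing the point of [v] is in [selfmeet f]; the complement of a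
    set avoiding that point is then in [selfmeet f], so the set itself is not even in [f]. *)
Lemma selfmeet_point n f v : upclosed n f -> size v = n ->
  count id v = 1%N -> selfmeet f v ->
  exists l, [/\ (l < n)%N, nth false v l &
    forall u, size u = n -> selfmeet f u = nth false u l /\ f u = nth false u l].
Proof.
move=> up sv cv gv; have [l ln [vl H]] := count1_nth _ _ sv cv.
have gl u : size u = n -> nth false u l -> selfmeet f u.
  move=> su ul; apply: (upclosed_selfmeet _ _ up v u) => //; exact: H.
exists l; split=> // u su; have [ul|ul] := boolP (nth false u l).
  by have gu := gl u su ul; rewrite gu; case/andP: gu.
have /gl : size (map negb u) = n by rewrite size_map.
rewrite (nth_map false) ?su // ul => /(_ isT) /andP[].
by rewrite map_negbK /selfmeet => -> /negbTE ->.
Qed.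

(** The difference at exponent k + 2 is q times the one at k + 1 plus p^(k+1) (q - p), and p^(k+1)
    <= p. *)
Lemma expr_sub_le k : q ^+ k.+1 - p ^+ k.+1 <= q - p.
Proof.
elim: k => [|k IH]; first by rewrite !expr1.
have pk : p ^+ k.+1 <= p by rewrite -[leRHS]expr1 ler_wiXn2l.
have := ler_wpM2l q_ge0 IH; have := qp_ge0.
move: pk; rewrite (exprS p k.+1) (exprS q k.+1).
set P := p ^+ _; set Q := q ^+ _ => pk qp /=.
have := ler_wpM2r qp pk.
rewrite q_def; nra.
Qed.

(** Exponent three is the first strict one: at one and two both sides agree because p + q = 1. *)
Lemma expr_sub_lt k : p < q -> q ^+ k.+3 - p ^+ k.+3 < q - p.
Proof.
move=> pq; have := expr_sub_le k.+1.
have pk : p ^+ k.+2 < p by rewrite -[ltRHS]expr1 ltr_iXn2l.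
rewrite (exprS p k.+2) (exprS q k.+2).
set P := p ^+ _ in pk *; set Q := q ^+ _ => IH.
have := ler_wpM2l q_ge0 IH.
have qp : 0 < q - p by rewrite subr_gt0.
have : P * (q - p) < p * (q - p) by rewrite ltr_pM2r.
rewrite q_def; nra.
Qed.

Lemma excess_nth n l f : (l < n)%N ->
  (forall v, size v = n -> f v = nth false v l) -> excess n f = 0.
Proof.
move=> ln fl; rewrite /excess.
rewrite !(eq_cubesum _ _ _ _ f (fun v => nth false v l)) //.
by rewrite !cubesum_nth // mulrC subrr.
Qed.

Lemma excess_pred0 n f : (forall v, size v = n -> ~~ f v) -> excess n f = 0.
Proof. by move=> f0; rewrite /excess !cubesum_pred0 // !mulr0 subrr. Qed.

(** The first alternative is the trace of the one-flip star at the removed point, the second that of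
    a one-flip star at another point. *)
Definition top_or_star n (f : pred (seq bool)) : Prop :=
  (forall v, size v = n -> f v = (v == nseq n true)) \/
  exists2 l, (l < n)%N & forall v, size v = n ->
    f v = nth false v l && (1 < count id v)%N.

Definition excess_bound n : Prop := forall f,
  upclosed n f -> antipode_free n f -> singleton_free n f -> f (nseq n true) ->
  p * q ^+ n - q * p ^+ n <= excess n f.

(** Four cases, by whether [f0] contains the top vector (otherwise it is empty) and whether g
    contains a singleton (then g is a star). Equality needs no induction of its own: each case reads
    it off from the bound one dimension lower. *)
Lemma excess_bound_cons n f : (0 < n)%N -> excess_bound n ->
  upclosed n.+1 f -> antipode_free n.+1 f -> singleton_free n.+1 f ->
  f (nseq n.+1 true) ->
  p * q ^+ n.+1 - q * p ^+ n.+1 <= excess n.+1 f /\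
  (p < q -> (2 < n)%N -> excess n.+1 f = p * q ^+ n.+1 - q * p ^+ n.+1 ->
   top_or_star n.+1 f).
Proof.
move=> n0 IH up af sf ftop.
rewrite (excess_cons _ _ up af) /=.
set f0 := fun v => f (false :: v); set f1 := fun v => f (true :: v).
set g := selfmeet f1; set Z := cubesum p q n _.
have Z0 : 0 <= Z by apply: cubesum_ge0.
have up0 : upclosed n f0 by apply: upclosed_cons.
have up1 : upclosed n f1 by apply: upclosed_cons.
have upg : upclosed n g by apply: upclosed_selfmeet.
have afg : antipode_free n g := antipode_free_selfmeet n f1.
have sf0 : singleton_free n f0.
  by move=> v sv /sf /=; rewrite sv => /(_ erefl).
have bot1 : ~~ f1 (nseq n false).
  apply/negP => /sf /=; rewrite size_nseq => /(_ erefl).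
  by rewrite count_nseq mul0n.
have gtop : g (nseq n true).
  have f1top : f1 (nseq n true) := ftop.
  by rewrite /g /selfmeet f1top map_nseq bot1.
have f0g v : size v = n -> f0 v -> g v.
  move=> sv f0v; rewrite /g /selfmeet /f1 (upclosed_cons_sub _ _ _ up) //=.
  by apply: (af (false :: v)); rewrite /= ?sv.
have af0 : antipode_free n f0.
  move=> v sv /(f0g _ sv) /(afg _ sv); apply: contra; apply: f0g.
  by rewrite size_map.
have posP : 0 < p ^+ n by rewrite exprn_gt0.
have posQ : 0 < q ^+ n by rewrite exprn_gt0.
have sfg : ~~ [exists v : n.-tuple bool, (count id v == 1%N) && g v] ->
    singleton_free n g.
  move=> gN v sv gv; rewrite ltnNge; apply/negP; rewrite leq_eqVlt ltnS leqn0.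
  case/orP => [cv|/eqP /(count_id_eq0_nseq _ _ sv) ve].
    case/existsP: gN; have /eqP sv' := sv.
    by exists (Tuple sv'); rewrite cv.
  by move: gv; rewrite ve => /andP[]; rewrite (negbTE bot1).
have [f0top|f0top] := boolP (f0 (nseq n true)); last first.
  have f0N v : size v = n -> ~~ f0 v.
    move=> sv; apply: contra f0top; apply: up0; rewrite ?size_nseq //.
    exact: all2_implb_nseq.
  rewrite (excess_pred0 _ _ f0N) mulr0 add0r.
  have [/existsP[v /andP[/eqP cv gv]]|gN] :=
      boolP [exists v : n.-tuple bool, (count id v == 1%N) && g v].
    have [l [ln vl H]] := selfmeet_point n f1 v up1 (size_tuple v) cv gv.
    rewrite (excess_nth n l) //; last by move=> u /H[].
    (* Here g is the star at l, of mu_q-measure q, and [f0] is empty, so the claim reduces to q^n -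
       p^n <= q - p. *)
    have -> : Z = q.
      rewrite /Z -[RHS](@cubesum_nth R p q n l) //; apply: eq_cubesum => u su.
      by rewrite -/(f0 u) (negbTE (f0N u su)) andbT; case: (H u su).
    rewrite mulr0 add0r !exprS !mulrA [q * p]mulrC -mulrBr.
    rewrite [leRHS]mulrAC.
    have pq0 : 0 < p * q by rewrite mulr_gt0.
    split; first by rewrite ler_pM2l //; case: (n) n0 => // k _; apply: expr_sub_le.
    move=> pq n2 /eqP; rewrite mulrAC (inj_eq (mulfI (lt0r_neq0 pq0))).
    move: n2; case: (n) => [|[|[|k]]] // _.
    by rewrite gt_eqF // expr_sub_lt.
  have Dg := IH _ upg afg (sfg gN) gtop.
  have EZ : Z = cubesum p q n g.
    apply: eq_cubesum => v sv; by rewrite -/(f0 v) (negbTE (f0N v sv)) andbT.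
  have full : count id (nseq n true) = n by rewrite count_nseq mul1n.
  have Zge : q ^+ n <= Z.
    have := @cubesum_ge_point R p q n g _ p_ge0 q_ge0 (size_nseq n true) gtop.
    by rewrite full subnn mul1r EZ.
  have qp0 : 0 <= p * (q - p) by rewrite mulr_ge0.
  have h1 := ler_wpM2l p_ge0 Dg.
  have h2 := ler_wpM2l qp0 Zge.
  (* The bound for g and the weight q^n of the top vector add up exactly to the target. *)
  have E : p * q ^+ n.+1 - q * p ^+ n.+1 =
     p * (p * q ^+ n - q * p ^+ n) + p * (q - p) * q ^+ n.
    by rewrite !exprS; ring.
  split; first by rewrite E lerD.
  move=> pq _ eqn.
  (* Equality leaves g no more mass than the top vector has, so g contains nothing else. *)
  have Zle : Z <= q ^+ n.
    rewrite -(@ler_pM2l _ (p * (q - p))) ?mulr_gt0 ?subr_gt0 //; lra.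
  have g1 u : size u = n -> g u -> u = nseq n true.
    move=> su gu; apply: (cubesum_point_eq _ p q n g) => //.
      by rewrite size_nseq.
    by rewrite full subnn mul1r -EZ.
  have f1C u : size u = n -> f1 u -> u != nseq n true -> f1 (map negb u).
    move=> su f1u ut; apply: contraNT ut => nf.
    by rewrite (g1 u su) // /g /selfmeet f1u nf.
  (* f1 is closed under complement, apart from the top vector: it contains either
     only the top vector or every nonzero vector u. For the latter, join u with
     some v in f1: the join w is the top only if the complement of v is below u. *)
  have [/existsP[v /andP[f1v vt]]|f1N] :=
      boolP [exists v : n.-tuple bool, f1 v && (val v != nseq n true)].
    have sv := size_tuple v.
    right; exists 0%N => //; case=> [|[] u] //= [su]; last exact/negbTE/f0N.
    rewrite -/(f1 u) ltnS lt0n; apply/idP/idP => [f1u|u0].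
      apply: contraL f1u => /eqP /(count_id_eq0_nseq _ _ su) ->; exact: bot1.
    have uN : map negb u != nseq n true.
      apply: contra u0 => /eqP uN; rewrite -(map_negbK u) uN map_nseq.
      by rewrite count_nseq mul0n.
    have [w [sw uw vw wtop]] := all2_implb_join _ _ _ su sv.
    have [wt|wt] := eqVneq w (nseq n true).
      by apply: (up1 _ _ _ _ (wtop wt) (f1C _ sv f1v vt)); rewrite ?size_map.
    rewrite -(map_negbK u); apply: (f1C); rewrite ?size_map //.
    have f1w := up1 _ _ sv sw vw f1v.
    apply: (up1 _ _ _ _ (all2_implb_negb _ _ uw) (f1C _ sw f1w wt));
      by rewrite size_map.
  left; case=> [|[] u] //= [su]; last exact/negbTE/f0N.
  rewrite eqseq_cons eqxx /= -/(f1 u); apply/idP/eqP => [f1u|->]; last exact: ftop.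
  apply/eqP; apply: contraNT f1N => ut; apply/existsP.
  by have /eqP su' := su; exists (Tuple su'); rewrite f1u.
have IH0 := IH f0 up0 af0 sf0 f0top.
have n2 : (1 < n)%N.
  have := sf0 _ (size_nseq n true) f0top.
  by rewrite count_nseq mul1n.
have [/existsP[v /andP[/eqP cv gv]]|gN] :=
    boolP [exists v : n.-tuple bool, (count id v == 1%N) && g v].
  have sv := size_tuple v.
  have [l [ln vl H]] := selfmeet_point n f1 v up1 sv cv gv.
  rewrite (excess_nth n l g) // ?mulr0 ?addr0; last by move=> u /H[].
  (* The excess of the star g vanishes; the weight of [v], a singleton in g but not in [f0], makes
     up exactly for the missing term. *)
  have nf0v : ~~ f0 v by apply/negP => f0v; have := sf0 _ sv f0v; rewrite cv.
  pose gNf0 v := g v && ~~ f0 v; have gv' : gNf0 v by rewrite /gNf0 gv.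
  have Zge := @cubesum_ge_point R p q n gNf0 v p_ge0 q_ge0 sv gv'.
  rewrite -/Z cv expr1 in Zge.
  have E : p * q ^+ n.+1 - q * p ^+ n.+1 =
      q * (p * q ^+ n - q * p ^+ n) + p * (q - p) * (p ^+ (n - 1) * q).
    have -> : p ^+ n.+1 = p * p ^+ n by rewrite exprS.
    have -> : p ^+ n = p * p ^+ (n - 1) by rewrite -exprS subn1 prednK.
    by rewrite exprS q_def; ring.
  have qp0 : 0 <= p * (q - p) by rewrite mulr_ge0.
  split; first by rewrite E lerD // ler_wpM2l.
  move=> pq _ eqn.
  (* Equality makes [v] the only member of g outside [f0], so [f0] is the star at l without its
     singleton. The centre becomes [l.+1] once the first coordinate is restored. *)
  have Zle : Z <= p ^+ (n - 1) * q.
    rewrite -(@ler_pM2l _ (p * (q - p))) ?mulr_gt0 ?subr_gt0 //.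
    have := ler_wpM2l q_ge0 IH0; lra.
  have gf0 u : size u = n -> g u -> ~~ f0 u -> u = v :> seq bool.
    move=> su gu nf0u; apply: (cubesum_point_eq _ p q n gNf0) => //.
      by rewrite cv expr1.
    by rewrite /gNf0 gu.
  right; exists l.+1 => //; case=> [|b u] //= [su].
  have [gl fl] := H u su; case: b => /=.
    rewrite -/(f1 u) fl ltnS; have [ul|//] := boolP (nth false u l).
    by rewrite -has_count; apply/esym/(has_nthP false); exists l; rewrite ?su.
  rewrite -/(f0 u) add0n -gl; apply/idP/andP => [f0u|[gu cu]].
    by split; [exact: f0g | exact: sf0].
  by apply: contraLR cu => /(gf0 u su gu) ->; rewrite cv.
have Dg := IH _ upg afg (sfg gN) gtop.
(* With n = k + 2, this is the surplus of the two induction bounds over the target. It vanishes at n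
   = 2, so equality is not excluded there: on four points the triangle systems attain it. *)
have Eqp (k : nat) : q * (p * q ^+ k.+2 - q * p ^+ k.+2)
    + p * (p * q ^+ k.+2 - q * p ^+ k.+2)
    - (p * q ^+ k.+3 - q * p ^+ k.+3) = p ^+ 2 * q ^+ 2 * (q ^+ k - p ^+ k).
  by rewrite !exprS q_def; ring.
have h0 := ler_wpM2l q_ge0 IH0; have h1 := ler_wpM2l p_ge0 Dg.
have h2 : 0 <= p * (q - p) * Z by rewrite !mulr_ge0.
case: (n) n2 h0 h1 => [|[|k]] // _ h0 h1; have Ek := Eqp k.
split.
  have : 0 <= p ^+ 2 * q ^+ 2 * (q ^+ k - p ^+ k).
    by rewrite !mulr_ge0 ?exprn_ge0 // subr_ge0 lerXn2r ?nnegrE.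
  move: Ek h0 h1 h2; lra.
move=> pq k0 eqn.
have : 0 < p ^+ 2 * q ^+ 2 * (q ^+ k - p ^+ k).
  by rewrite !mulr_gt0 ?exprn_gt0 // subr_gt0 ltrXn2r ?nnegrE // -lt0n.
move: Ek h0 h1 h2 eqn; lra.
Qed.

Lemma excess_ge n : (0 < n)%N -> excess_bound n.
Proof.
case: n => // n _; elim: n => [|n IH] f up af sf ftop.
  (* In dimension one the top vector is a singleton, so the base case is vacuous. *)
  by have := sf _ _ ftop; rewrite /= => /(_ erefl).
by have [] := excess_bound_cons n.+1 f isT IH up af sf ftop.
Qed.

Lemma excess_eq n f : p < q -> (3 < n)%N ->
  upclosed n f -> antipode_free n f -> singleton_free n f -> f (nseq n true) ->
  excess n f = p * q ^+ n - q * p ^+ n -> top_or_star n f.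
Proof.
case: n => // n pq n3 up af sf ftop eqn.
have n0 : (0 < n)%N by case: (n) n3.
by have [_] := excess_bound_cons n f n0 (excess_ge n n0) up af sf ftop; apply.
Qed.

End Excess.

(** * Maximal intersecting families *)

Definition bitset (n : nat) (v : seq bool) : {set 'I_n} :=
  [set i : 'I_n | nth false v i].

Lemma bitset_false n v : bitset n.+1 (false :: v) = lift ord0 @: bitset n v.
Proof.
apply/setP => i; rewrite inE; case: (unliftP ord0 i) => [j|] -> /=.
  by rewrite (mem_imset _ _ lift_inj) inE.
by apply/esym/imsetP => -[j _] /eqP; rewrite (negbTE (neq_lift _ _)).
Qed.

Lemma bitset_true n v :
  bitset n.+1 (true :: v) = ord0 |: lift ord0 @: bitset n v.
Proof.
rewrite -bitset_false; apply/setP => i; rewrite !inE.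
by case: (unliftP ord0 i) => [j|] ->.
Qed.

Lemma bitset_negb n v : size v = n -> bitset n (map negb v) = ~: bitset n v.
Proof. by move=> sv; apply/setP => i; rewrite !inE (nth_map false) // sv. Qed.

Lemma bitset_sub n u v : all2 implb u v -> bitset n u \subset bitset n v.
Proof.
move=> uv; apply/subsetP => i; rewrite !inE; move: (nat_of_ord i) => {i} i.
elim: u v i uv => [|a u IH] [|b v] [|i] //= /andP[ab uv]; last exact: IH.
exact/implyP.
Qed.

Lemma card_bitset n v : size v = n -> #|bitset n v| = count id v.
Proof.
move=> <-; rewrite -sum1_count (big_nth false) big_mkord -sum1_card.
by apply: eq_bigl => i; rewrite inE.
Qed.

Lemma bitset_onto n (S : {set 'I_n}) : exists2 v, size v = n & bitset n v = S.
Proof.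
exists [seq i \in S | i <- enum 'I_n]; first by rewrite size_map size_enum_ord.
apply/setP => i; rewrite inE (nth_map i) ?size_enum_ord //.
by rewrite nth_ord_enum.
Qed.

Lemma bitset_onto0 m (S : {set 'I_m.+1}) : ord0 \notin S ->
  exists2 v, size v = m & bitset m.+1 (false :: v) = S.
Proof.
have [[//|[] v] /= [sv] <-] := bitset_onto _ S; first by rewrite inE.
by exists v.
Qed.

Lemma sum_set_ordS (V : nmodType) n (phi : {set 'I_n.+1} -> V) :
  \sum_(S : {set 'I_n.+1}) phi S
  = \sum_(S : {set 'I_n}) phi (lift ord0 @: S)
    + \sum_(S : {set 'I_n}) phi (ord0 |: lift ord0 @: S).
Proof.
pose pre (T : {set 'I_n.+1}) : {set 'I_n} := lift ord0 @^-1: T.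
have preK (S : {set 'I_n}) : pre (lift ord0 @: S) = S.
  by apply/setP => i; rewrite inE (mem_imset _ _ lift_inj).
have preUK (S : {set 'I_n}) : pre (ord0 |: lift ord0 @: S) = S.
  by apply/setP => i; rewrite !inE /= (mem_imset _ _ lift_inj).
have no0 (S : {set 'I_n}) : (ord0 \in lift ord0 @: S) = false.
  by apply/imsetP => -[j _] /eqP; rewrite (negbTE (neq_lift _ _)).
have Kpre (T : {set 'I_n.+1}) j :
    (lift ord0 j \in lift ord0 @: pre T) = (lift ord0 j \in T).
  by rewrite (mem_imset _ _ lift_inj) inE.
rewrite (bigID (fun S : {set 'I_n.+1} => ord0 \in S)) /= addrC; congr (_ + _).
  rewrite (reindex_onto (fun S : {set 'I_n} => lift ord0 @: S) pre) /=.
    by apply: eq_bigl => S; rewrite no0 preK eqxx.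
  move=> T T0; apply/setP => i.
  by case: (unliftP ord0 i) => [j|] ->; rewrite ?Kpre // no0 (negbTE T0).
rewrite (reindex_onto (fun S : {set 'I_n} => ord0 |: lift ord0 @: S) pre) /=.
  by apply: eq_bigl => S; rewrite setU11 preUK eqxx.
move=> T T0; apply/setP => i.
by case: (unliftP ord0 i) => [j|] ->; rewrite in_setU1 ?Kpre // T0.
Qed.

Lemma sum_cubesum (R : realFieldType) (p : R) n (P : pred {set 'I_n}) :
  \sum_(S | P S) p ^+ #|S| * (1 - p) ^+ (n - #|S|)
  = cubesum (1 - p) p n (fun v => P (bitset n v)).
Proof.
rewrite big_mkcond /=; elim: n P => [|n IH] P.
  have set0E (S : {set 'I_0}) : S = bitset 0 [::].
    by apply/setP => -[].
  rewrite /= (big_pred1 (bitset 0 [::])) => [|S]; last first.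
    by rewrite /= (set0E S) eqxx.
  have -> : #|bitset 0 [::]| = 0%N by rewrite card_bitset.
  by rewrite mulr1; case: ifP.
rewrite sum_set_ordS /=; congr (_ + _).
  rewrite (eq_cubesum _ _ _ _ _ (fun v => P (lift ord0 @: bitset n v))); last first.
    by move=> v _; rewrite bitset_false.
  rewrite -(IH (fun S => P (lift ord0 @: S))) mulr_sumr; apply: eq_bigr => S _.
  case: ifP; rewrite ?mulr0 // (card_imset _ lift_inj) subSn ?exprS.
    by rewrite mulrCA.
  by rewrite -[leqRHS]card_ord max_card.
rewrite (eq_cubesum _ _ _ _ _
  (fun v => P (ord0 |: lift ord0 @: bitset n v))); last first.
  by move=> v _; rewrite bitset_true.
rewrite -(IH (fun S => P (ord0 |: lift ord0 @: S))) mulr_sumr.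
apply: eq_bigr => S _; case: ifP; rewrite ?mulr0 //.
have no0 : ord0 \notin lift ord0 @: S.
  by apply/imsetP => -[j _] /eqP; rewrite (negbTE (neq_lift _ _)).
by rewrite cardsU1 no0 (card_imset _ lift_inj) add1n subSS exprS mulrA.
Qed.

Lemma mu_cubesum (R : realType) n (p : R) (F : {set {set 'I_n}}) :
  mu p F = cubesum (1 - p) p n (fun v => bitset n v \in F).
Proof. exact: (sum_cubesum R p n (fun S => S \in F)). Qed.

(** * Complementary pairs, kernels and one-flip stars *)

Section Families.
Variable n : nat.
Implicit Types (F C : {set {set 'I_n}}) (S T : {set 'I_n}) (a : 'I_n).

Lemma intersectingP F :
  reflect ((forall S, S \in F -> S != set0) /\
           (forall S T, S \in F -> T \in F -> S :&: T != set0))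
          (intersecting F).
Proof.
apply: (iffP andP) => -[FV FF]; split.
- by move=> S /(subsetP FV); rewrite inE.
- by move=> S T SF TF; move/forall_inP: FF => /(_ S SF) /forall_inP; apply.
- by apply/subsetP => S /FV; rewrite inE.
by apply/forall_inP => S SF; apply/forall_inP => T TF; apply: FF.
Qed.

(** Adding [S] keeps the family intersecting, so maximality puts it there already. *)
Lemma maximal_mem F S : maximal_intersecting F -> S != set0 ->
  (forall T, T \in F -> S :&: T != set0) -> S \in F.
Proof.
move=> /maxsetP[/intersectingP[F0 FI] Fmax] S0 SI.
rewrite -(Fmax (S |: F)) ?setU11 ?subsetU1 //; apply/intersectingP; split.
  by move=> T /setU1P[->|/F0].
move=> T U /setU1P[->|TF] /setU1P[->|UF].
- by rewrite setIid.
- exact: SI.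
- by rewrite setIC SI.
exact: FI.
Qed.

Lemma maximal_up F S T : maximal_intersecting F -> S \in F -> S \subset T ->
  T \in F.
Proof.
move=> Fmax SF ST.
have /intersectingP[F0 FI] := maxsetp Fmax.
apply: maximal_mem => //.
  by apply: contra_neq (F0 S SF) => T0; apply/eqP; rewrite -subset0 -T0.
move=> U UF; apply: contra_neq (FI _ _ SF UF) => TU.
by apply/eqP; rewrite -subset0 -TU setSI.
Qed.

Lemma intersecting_setC F S : intersecting F -> S \in F -> ~: S \notin F.
Proof.
move=> /intersectingP[_ FI] SF; apply/negP => /(FI _ _ SF).
by rewrite setICr eqxx.
Qed.

(** If a nonempty [S] is missing, some member is disjoint from it, hence contained in its
    complement, and [F] is closed upwards. For empty [S] the complement is the full set, which meets
    every member. *)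
Lemma maximal_setC F S : (0 < n)%N -> maximal_intersecting F ->
  (~: S \in F) = (S \notin F).
Proof.
move=> n0 Fmax; have FI := maxsetp Fmax.
apply/idP/idP => [|SF]; first by rewrite -{2}(setCK S); apply: intersecting_setC.
have [S0|Sn0] := eqVneq S set0.
  rewrite S0 setC0; apply: maximal_mem => // [|T TF].
    by rewrite -cards_eq0 cardsT card_ord -lt0n.
  by rewrite setTI; case/intersectingP: FI => /(_ T TF).
have : ~~ [forall T in F, S :&: T != set0].
  by apply: contra SF => /forall_inP; apply: maximal_mem.
rewrite negb_forall_in => /exists_inP[T TF]; rewrite negbK setI_eq0 => ST.
by apply: maximal_up TF _; rewrite -?disjoints_subset // disjoint_sym.
Qed.

(** A member of [F] outside [C] would have its complement in [C], hence in [F]. *)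
Lemma intersecting_eq_half F C : intersecting F -> C \subset F ->
  (forall S, (S \in C) || (~: S \in C)) -> F = C.
Proof.
move=> FI CF half; apply/eqP; rewrite eqEsubset CF andbT.
apply/subsetP => S SF; have := half S; case: (S \in C) => //= SC.
by have := intersecting_setC _ _ FI SF; rewrite (subsetP CF).
Qed.

Lemma ker_subset F C : F \subset C -> ker C \subset ker F.
Proof.
move=> FC; apply/subsetP => x /bigcapP xC; apply/bigcapP => S SF.
by apply: xC; apply: (subsetP FC).
Qed.

(** Enlarging a family can only shrink its kernel. *)
Lemma nontrivial_extend F : nontrivial_intersecting F ->
  exists C, [/\ maximal_intersecting C, ker C == set0 & F \subset C].
Proof.
case/andP=> FI kF; have [C Cmax FC] := maxset_exists FI.
by exists C; split=> //; rewrite -subset0 -(eqP kF) ker_subset.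
Qed.

(** A singleton member would have its point in every other member, hence in the kernel. *)
Lemma nontrivial_card F S : nontrivial_intersecting F -> S \in F ->
  (1 < #|S|)%N.
Proof.
move=> /andP[/intersectingP[F0 FI] /eqP kF] SF; rewrite ltnNge.
apply/negP => S1; have /cards1P[a Sa] : #|S| == 1%N.
  by rewrite eqn_leq S1 card_gt0 F0.
suff : a \in ker F by rewrite kF inE.
apply/bigcapP => T TF; have := FI _ _ SF TF.
by rewrite Sa; apply: contraR => aT; rewrite setI_eq0 disjoints1.
Qed.

Lemma maximal_card_ge F S : (0 < n)%N -> maximal_intersecting F ->
  ker F == set0 -> (n <= #|S|.+1)%N -> S \in F.
Proof.
move=> n0 Fmax kF nS; rewrite -[S]setCK maximal_setC //.
have nt : nontrivial_intersecting F by rewrite /nontrivial_intersecting maxsetp.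
apply/negP => /(nontrivial_card _ _ nt).
by have := cardsC S; rewrite card_ord; lia.
Qed.

Lemma card_setTD1 a : #|[set: 'I_n] :\ a| = n.-1.
Proof.
by have := cardsD1 a [set: 'I_n]; rewrite inE cardsT card_ord => /(congr1 predn).
Qed.

Lemma in_one_flip_star a S :
  (S \in one_flip_star a) = (a \in S) && (1 < #|S|)%N || (S == [set: 'I_n] :\ a).
Proof.
rewrite !inE; congr (_ || _); case: (boolP (a \in S)) => [aS|]; rewrite ?andbF //.
have -> : S != set0 by apply: contraTneq aS => ->; rewrite inE.
by rewrite !andbT /= eq_sym eqEcard sub1set aS cards1 -ltnNge.
Qed.

Lemma one_flip_half a S : (S \in one_flip_star a) || (~: S \in one_flip_star a).
Proof.
wlog aS : S / a \in S.
  move=> H; case: (boolP (a \in S)) => [/H //|aS].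
  by rewrite orbC -{2}(setCK S); apply: H; rewrite inE.
rewrite !in_one_flip_star aS /=; case: ltnP => //= S1.
have -> : S = [set a].
  by apply/eqP; rewrite eq_sym eqEcard sub1set aS cards1.
by rewrite setTD eqxx !orbT.
Qed.

Lemma nontrivial_one_flip a : (2 < n)%N -> nontrivial_intersecting (one_flip_star a).
Proof.
move=> n2; have cC := card_setTD1 a.
have meet S T : a \in S -> (1 < #|S|)%N -> T = [set: 'I_n] :\ a -> S :&: T != set0.
  move=> aS S1 ->; rewrite setTD -setDE -card_gt0.
  by move: S1; rewrite (cardsD1 a S) aS.
apply/andP; split.
  apply/intersectingP; split=> [S|S T].
    rewrite in_one_flip_star -card_gt0 => /orP[/andP[_ /ltnW //]|/eqP->].
    by rewrite cC; lia.
  rewrite !in_one_flip_star => /orP[/andP[aS S1]|/eqP SC] /orP[/andP[aT T1]|/eqP TC].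
  - by apply/set0Pn; exists a; rewrite inE aS.
  - exact: meet.
  - by rewrite setIC meet.
  - by rewrite SC TC setIid -card_gt0 cC; lia.
apply/eqP/setP => x; rewrite [RHS]inE; apply/bigcapP => kx.
(* The member [n] minus a excludes a from the kernel; any other x is excluded by its own complement,
   which contains a and has n - 1 > 1 points. *)
have xa : x != a.
  have := kx ([set: 'I_n] :\ a); rewrite in_one_flip_star eqxx orbT => /(_ isT).
  by rewrite !inE andbT.
have := kx (~: [set x]); rewrite in_one_flip_star !inE eqxx eq_sym xa /=.
have := cardsC [set x]; rewrite cards1 card_ord => cx.
have -> : (1 < #|~: [set x]|)%N by lia.
by move=> /(_ isT).
Qed.

Lemma maximal_one_flip F a : (1 < n)%N -> maximal_intersecting F ->
  ker F == set0 ->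
  (forall S, a \in S -> (1 < #|S|)%N -> S \in F) -> F = one_flip_star a.
Proof.
move=> n1 Fmax kF aF; apply: intersecting_eq_half (one_flip_half a).
  exact: maxsetp Fmax.
apply/subsetP => S; rewrite in_one_flip_star => /orP[/andP[]|/eqP ->].
  exact: aF.
apply: maximal_card_ge => //; first exact: ltnW.
by rewrite card_setTD1 leqSpred.
Qed.

(** For c other than a and b, the pair {a, c} separates the two families: it avoids b and is too
    small to be [n] minus b. *)
Lemma one_flip_star_inj : (3 < n)%N -> injective (@one_flip_star n).
Proof.
move=> n3 a b ab; apply/eqP; apply: contraT => nab.
have : (0 < #|~: [set a; b]|)%N.
  by have := cardsC [set a; b]; rewrite cards2 nab card_ord; lia.
case/card_gt0P => c; rewrite !inE negb_or => /andP[ca cb].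
have : [set a; c] \in one_flip_star a.
  by rewrite in_one_flip_star !inE eqxx cards2 eq_sym ca.
rewrite ab in_one_flip_star !inE eq_sym (negbTE nab) eq_sym (negbTE cb) /=.
move=> /eqP E; have := card_setTD1 b.
by rewrite -E cards2 eq_sym ca; lia.
Qed.

End Families.

(** * Measures of families, and the bound for maximal ones through their traces *)

Section Measure.
Variables (R : realType) (p : R).
Hypotheses (p_gt0 : 0 < p) (p_lt1 : p < 1).
Implicit Types n : nat.

Lemma weight_gt0 n (S : {set 'I_n}) : 0 < p ^+ #|S| * (1 - p) ^+ (n - #|S|).
Proof. by rewrite mulr_gt0 // exprn_gt0 // subr_gt0. Qed.

Lemma mu_ge0 n (F : {set {set 'I_n}}) : 0 <= mu p F.
Proof. by apply: sumr_ge0 => S _; apply/ltW/weight_gt0. Qed.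

Lemma mu_setD n (F C : {set {set 'I_n}}) : F \subset C ->
  mu p C = mu p F + mu p (C :\: F).
Proof.
move=> FC; rewrite /mu (big_setID F) /=; congr (_ + _).
apply: eq_bigl => S; rewrite inE.
by case: (boolP (S \in F)) => [/(subsetP FC) ->|]; rewrite ?andbF.
Qed.

Lemma mu_le n (F C : {set {set 'I_n}}) : F \subset C -> mu p F <= mu p C.
Proof. by move=> /mu_setD ->; rewrite lerDl mu_ge0. Qed.

Lemma mu_lt n (F C : {set {set 'I_n}}) : F \proper C -> mu p F < mu p C.
Proof.
case/properP => FC [S SC SF]; rewrite (mu_setD _ _ _ FC) ltrDl.
rewrite /mu (bigD1 S) /=; last by rewrite inE SF.
rewrite ltr_wpDr ?weight_gt0 //.
by apply: sumr_ge0 => T _; apply/ltW/weight_gt0.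
Qed.

Lemma mu_Star n (a : 'I_n) : mu p (Star a) = p.
Proof.
rewrite mu_cubesum (eq_cubesum _ _ _ _ _ (fun v => nth false v a)).
  by rewrite cubesum_nth // subrK.
move=> v _; rewrite !inE andbC; case: (boolP (nth false v a)) => //= va.
by apply/set0Pn; exists a; rewrite inE.
Qed.

Lemma mu_one_flip_star n (a : 'I_n) :
  mu p (one_flip_star a) = p - p * (1 - p) ^+ (n - 1) + (1 - p) * p ^+ (n - 1).
Proof.
have n0 : (0 < n)%N by case: n a => [[]|].
have cC : #|[set: 'I_n] :\ a| = (n - 1)%N.
  by rewrite card_setTD1 subn1.
rewrite /mu /one_flip_star setUC big_setU1 /=; last first.
  by rewrite !inE eqxx /= !andbF.
rewrite cC subKn // expr1 mulrC addrC; congr (_ + _).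
have := mu_Star n a; rewrite /mu (big_setD1 [set a]) /=; last first.
  by rewrite !inE eqxx andbT; apply/set0Pn; exists a; rewrite inE.
by rewrite cards1 expr1 => /(canRL (addKr _)) ->; rewrite addrC.
Qed.

(** The members through the first point are the complements of the non-members avoiding it.
    Complementation exchanges p and q, so these members contribute p (1 - mu_q(G)), where G is the
    trace. *)
Lemma mu_maximal m (F : {set {set 'I_m.+1}}) : maximal_intersecting F ->
  mu p F = p - excess R p (1 - p) m (fun v => bitset m.+1 (false :: v) \in F).
Proof.
move=> Fmax; rewrite mu_cubesum /= /excess.
set f0 := fun v => bitset m.+1 (false :: v) \in F.
have -> : cubesum (1 - p) p m (fun v => bitset m.+1 (true :: v) \in F)
    = 1 - cubesum p (1 - p) m f0.
  rewrite -(cubesum_negb _ (1 - p) p) -cubesum_predC ?subrK //; apply: eq_cubesum => v sv.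
  rewrite /f0 -(maximal_setC _ F) // -bitset_negb /= ?size_map ?sv //.
  by rewrite map_negbK.
ring.
Qed.

Lemma maximal_half m (F : {set {set 'I_m.+1}}) : maximal_intersecting F ->
  p = 1 / 2 -> mu p F = 1 / 2.
Proof.
move=> Fmax p2; rewrite mu_maximal // /excess.
have -> : 1 - p = p by rewrite p2; lra.
by rewrite subrr subr0.
Qed.

Section MaximalFamily.
Variables (m : nat) (F : {set {set 'I_m.+1}}).
Hypotheses (m_gt1 : (1 < m)%N) (Fmax : maximal_intersecting F).
Hypothesis (kF : ker F == set0).

Let f0 v := bitset m.+1 (false :: v) \in F.

Let Fnt : nontrivial_intersecting F.
Proof. by rewrite /nontrivial_intersecting kF (maxsetp Fmax). Qed.

Lemma link_upclosed : upclosed m f0.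
Proof.
by move=> u v su sv uv /(maximal_up _ _ _ _ Fmax); apply; apply: bitset_sub.
Qed.

(** Adding the first point to [v] stays in [F], and the complement of the enlarged set is the
    complement of [v] among the remaining points. *)
Lemma link_antipode_free : antipode_free m f0.
Proof.
move=> v sv vF; rewrite /f0 -(maximal_setC _ F) // -bitset_negb /= ?size_map ?sv //.
rewrite map_negbK; apply: maximal_up vF _ => //; apply: bitset_sub => /=.
by elim: v {sv} => //= -[].
Qed.

Lemma link_singleton_free : singleton_free m f0.
Proof.
move=> v sv /(nontrivial_card _ _ _ Fnt).
by rewrite card_bitset //= sv.
Qed.

Lemma link_top : f0 (nseq m true).
Proof.
apply: maximal_card_ge => //; rewrite card_bitset /= ?size_nseq //.
by rewrite count_nseq mul1n.
Qed.

Lemma maximal_bound : p <= 1 / 2 ->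
  mu p F <= p - p * (1 - p) ^+ m + (1 - p) * p ^+ m.
Proof.
move=> p2; have pq : p <= 1 - p by lra.
have := excess_ge R p (1 - p) p_gt0 pq (subrKC _ _) m (ltnW m_gt1) f0
  link_upclosed link_antipode_free link_singleton_free link_top.
by rewrite mu_maximal // -/f0; lra.
Qed.

Lemma maximal_equality : p < 1 / 2 -> (3 < m)%N ->
  mu p F = p - p * (1 - p) ^+ m + (1 - p) * p ^+ m ->
  exists a, F = one_flip_star a.
Proof.
move=> p2 m3; rewrite mu_maximal // -/f0 => eqF.
have pq : p <= 1 - p by lra.
have pq' : p < 1 - p by lra.
have m1 : (1 < m.+1)%N := ltnW m_gt1.
have eqE : excess R p (1 - p) m f0 = p * (1 - p) ^+ m - (1 - p) * p ^+ m by lra.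
have [top|[l ln star]] := excess_eq R p (1 - p) p_gt0 pq (subrKC _ _) m f0 pq' m3
  link_upclosed link_antipode_free link_singleton_free link_top eqE.
  exists ord0; apply: maximal_one_flip => // S S0 S1.
  have [|v sv vS] := bitset_onto0 m (~: S); first by rewrite inE S0.
  rewrite -[S]setCK maximal_setC // -vS -/(f0 v) top //.
  apply: contraL S1 => /eqP v1; have := cardsC S.
  rewrite -vS v1 card_bitset /= ?size_nseq // card_ord count_nseq mul1n add0n.
  by move=> /(@addIn m _ 1%N) ->.
(* The centre l of the trace, renumbered in the full ground set. *)
pose a : 'I_m.+1 := lift ord0 (Ordinal ln).
have aE v : (a \in bitset m.+1 (false :: v)) = nth false v l by rewrite inE.
exists a; apply: maximal_one_flip => // S Sa S1; case: (boolP (ord0 \in S)) => S0.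
  have [|v sv vS] := bitset_onto0 m (~: S); first by rewrite inE S0.
  by rewrite -[S]setCK maximal_setC // -vS -/(f0 v) star // -aE vS inE Sa.
have [v sv vS] := bitset_onto0 m S S0.
rewrite -vS -/(f0 v) star // -aE vS Sa; move: S1.
by rewrite -vS card_bitset /= ?sv.
Qed.

End MaximalFamily.
End Measure.

(** * Ground sets of size four and three *)

Lemma in_triangle_system n (B S : {set 'I_n}) :
  (S \in triangle_system B) =
  [|| (S \subset B) && (#|S| == 2)%N, (#|S| == 3)%N | S == [set: 'I_n]].
Proof. by rewrite !inE subsetT /= -orbA. Qed.

Lemma card3_I4 (B : {set 'I_4}) : #|B| = 3%N -> exists x, B = ~: [set x].
Proof.
move=> B3; have := cardsC B; rewrite B3 card_ord => -[] /eqP /cards1P[x Bx].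
by exists x; rewrite -Bx setCK.
Qed.

Lemma in_triangle_system4 (d : 'I_4) (S : {set 'I_4}) :
  (S \in triangle_system (~: [set d])) =
  (2 < #|S|)%N || (#|S| == 2)%N && (d \notin S).
Proof.
have Sle : (#|S| <= 4)%N by rewrite -[leqRHS](card_ord 4) max_card.
rewrite in_triangle_system subsetC sub1set inE.
have -> : (S == [set: 'I_4]) = (4 <= #|S|)%N.
  by rewrite eqEcard subsetT cardsT card_ord.
rewrite andbC orbC -orbA.
by case: #|S| Sle => [|[|[|[|[|k]]]]] //; rewrite ?orbT ?orbF.
Qed.

Lemma triangle_half (d : 'I_4) (S : {set 'I_4}) :
  (S \in triangle_system (~: [set d])) || (~: S \in triangle_system (~: [set d])).
Proof.
have := cardsC S; rewrite card_ord !in_triangle_system4 inE => cS.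
by case: (d \in S); lia.
Qed.

Lemma nontrivial_triangle (d : 'I_4) :
  nontrivial_intersecting (triangle_system (~: [set d])).
Proof.
apply/andP; split.
  apply/intersectingP; split=> [S|S T]; rewrite !in_triangle_system4.
    by rewrite -card_gt0; lia.
  move=> hS hT; rewrite -card_gt0.
  have := cardsUI S T; have := cardsC (S :|: T); rewrite card_ord.
  (* A member through d has at least three points and any member at least two, more than four
     together. Two members avoiding d lie in the same three points, where two sets of size at least
     two meet. *)
  have [dS|dS] := boolP (d \in S); first by rewrite dS andbF orbF in hS; lia.
  have [dT|dT] := boolP (d \in T); first by rewrite dT andbF orbF in hT; lia.
  have : (0 < #|~: (S :|: T)|)%N.
    by apply/card_gt0P; exists d; rewrite !inE negb_or dS.
  lia.
apply/eqP/setP => x; rewrite [RHS]inE; apply/bigcapP => kx.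
have := kx (~: [set x]); rewrite in_triangle_system4 !inE eqxx.
by rewrite cardsC1 card_ord => /(_ isT).
Qed.

Lemma mu_triangle_system4 (R : realType) (p : R) (d : 'I_4) :
  mu p (triangle_system (~: [set d])) = p - p * (1 - p) ^+ 3 + (1 - p) * p ^+ 3.
Proof.
rewrite mu_cubesum (eq_cubesum _ _ _ _ _ (fun v =>
  (2 < count id v)%N || (count id v == 2)%N && ~~ nth false v d)); last first.
  by move=> v sv; rewrite in_triangle_system4 card_bitset // inE.
by case: d => [[|[|[|[|d]]]] //= d4]; ring.
Qed.

Section MaximalFour.
Variable F : {set {set 'I_4}}.
Hypotheses (Fmax : maximal_intersecting F) (kF : ker F == set0).

Lemma maximal_four_star (a : 'I_4) :
  (forall x, x != a -> [set a; x] \in F) -> F = one_flip_star a.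
Proof.
move=> aF; apply: maximal_one_flip => // S aS S1.
have : (0 < #|S :\ a|)%N by move: S1; rewrite (cardsD1 a S) aS.
case/card_gt0P => x /setD1P[xa xS]; apply: (maximal_up _ _ _ _ Fmax (aF x xa)).
by apply/subsetP => y /set2P[] ->.
Qed.

Lemma maximal_four_triangle (d : 'I_4) :
  (forall x y, x != d -> y != d -> x != y -> [set x; y] \in F) ->
  F = triangle_system (~: [set d]).
Proof.
move=> dF; apply: intersecting_eq_half (triangle_half d).
  exact: maxsetp Fmax.
apply/subsetP => S; rewrite in_triangle_system4.
move=> /orP[S3|/andP[/cards2P[x [y [xy SE]]]]].
  exact: maximal_card_ge.
by rewrite SE !inE negb_or => /andP[dx dy]; apply: dF; rewrite // eq_sym.
Qed.

Lemma I4_cases (P : pred 'I_4) :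
  P (inord 0) -> P (inord 1) -> P (inord 2) -> P (inord 3) -> forall x, P x.
Proof.
move=> P0 P1 P2 P3 x; rewrite -[x]inord_val.
by case: x => [[|[|[|[|x]]]] /= ?].
Qed.

(** The six pairs in [4] form three complementary couples, and [F] takes one pair from each. Of the
    eight choices, four consist of the pairs through one point and four of the pairs inside a
    triple. *)
Lemma maximal_four : (exists a, F = one_flip_star a) \/
  (exists d, F = triangle_system (~: [set d])).
Proof.
pose o i : 'I_4 := inord i; pose P i j := [set o i; o j] \in F.
have oE i j : (i < 4)%N -> (j < 4)%N -> (o i == o j) = (i == j).
  by move=> i4 j4; rewrite -val_eqE /= !inordK.
have PC i j : P i j = P j i by rewrite /P setUC.
have PN i j k l : (forall x : 'I_4, x \in [:: o i; o j] = (x \notin [:: o k; o l])) ->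
    P i j = ~~ P k l.
  move=> H; rewrite /P -maximal_setC //; congr (_ \in F).
  by apply/setP => x; have := H x; rewrite !inE.
have P01 : P 0 1 = ~~ P 2 3.
  by apply: PN => x; apply/eqP; move: x; apply: I4_cases; rewrite !inE !oE.
have P02 : P 0 2 = ~~ P 1 3.
  by apply: PN => x; apply/eqP; move: x; apply: I4_cases; rewrite !inE !oE.
have P03 : P 0 3 = ~~ P 1 2.
  by apply: PN => x; apply/eqP; move: x; apply: I4_cases; rewrite !inE !oE.
have star i : (forall j, (j < 4)%N -> j != i -> P i j) ->
    exists a, F = one_flip_star a.
  move=> Pi; exists (o i); apply: maximal_four_star => x xi.
  rewrite -[x]inord_val; apply: Pi => //.
  by apply: contra_neq xi => <-; rewrite /o inord_val.
have triangle k :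
    (forall i j, (i < 4)%N -> (j < 4)%N -> i != k -> j != k -> (i < j)%N ->
     P i j) ->
    exists d, F = triangle_system (~: [set d]).
  move=> Pk; exists (o k); apply: maximal_four_triangle => x y xk yk xy.
  have xk' : val x != k by apply: contra_neq xk => <-; rewrite /o inord_val.
  have yk' : val y != k by apply: contra_neq yk => <-; rewrite /o inord_val.
  rewrite -[x]inord_val -[y]inord_val.
  have [lt|lt|/val_inj E] := ltngtP (val x) (val y); last by rewrite E eqxx in xy.
    exact: Pk.
  by rewrite setUC; apply: Pk.
case: (boolP (P 0 1)) P01 => p01 /esym p23; case: (boolP (P 0 2)) P02 => p02 /esym p13;
  case: (boolP (P 0 3)) P03 => p03 /esym p12.
- by left; apply: (star 0%N) => -[|[|[|[|j]]]].
- right; apply: (triangle 3%N) => -[|[|[|[|i]]]] [|[|[|[|j]]]] // _ _ _ _ _.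
  exact: negbFE.
- right; apply: (triangle 2%N) => -[|[|[|[|i]]]] [|[|[|[|j]]]] // _ _ _ _ _.
  exact: negbFE.
- left; apply: (star 1%N) => -[|[|[|[|j]]]] // _ _; first by rewrite PC.
    exact: negbFE.
  exact: negbFE.
- right; apply: (triangle 1%N) => -[|[|[|[|i]]]] [|[|[|[|j]]]] // _ _ _ _ _.
  exact: negbFE.
- left; apply: (star 2%N) => -[|[|[|[|j]]]] // _ _; first by rewrite PC.
    by rewrite PC; apply: negbFE.
  exact: negbFE.
- left; apply: (star 3%N) => -[|[|[|[|j]]]] // _ _; rewrite PC //; exact: negbFE.
right; apply: (triangle 0%N) => -[|[|[|[|i]]]] [|[|[|[|j]]]] // _ _ _ _ _;
  exact: negbFE.
Qed.

End MaximalFour.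

(** A pair {d, c} with c different from d and e avoids e but not d. *)
Lemma triangle_system_inj4 (d e : 'I_4) :
  triangle_system (~: [set d]) = triangle_system (~: [set e]) -> d = e.
Proof.
move=> de; apply/eqP; apply: contraT => nde.
have : (0 < #|~: [set d; e]|)%N.
  by have := cardsC [set d; e]; rewrite cards2 nde card_ord; case: #|_|.
case/card_gt0P => c; rewrite !inE negb_or => /andP[cd ce].
have : [set d; c] \in triangle_system (~: [set e]).
  rewrite in_triangle_system4 !inE cards2 [d == c]eq_sym cd.
  by rewrite ![e == _]eq_sym (negbTE nde) (negbTE ce).
by rewrite -de in_triangle_system4 !inE cards2 [d == c]eq_sym cd eqxx.
Qed.

(** A pair avoiding both a and d lies in the triangle system, but is too small to be the one member
    of the one-flip star that avoids a. *)
Lemma one_flip_star_neq_triangle_system (a d : 'I_4) :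
  one_flip_star a != triangle_system (~: [set d]).
Proof.
apply/eqP => E.
pose S := [set a] :|: [set d].
have S2 : (#|S| <= 2)%N by rewrite cards2; case: (_ != _).
have : (1 < #|~: S|)%N by have := cardsC S; rewrite card_ord; lia.
case/card_gt1P => x [y [xS yS xy]].
have : [set x; y] \in triangle_system (~: [set d]).
  rewrite in_triangle_system4 cards2 xy /= !inE negb_or.
  by move: xS yS; rewrite !inE !negb_or ![d == _]eq_sym => /andP[_ ->] /andP[_ ->].
rewrite -E in_one_flip_star => /orP[/andP[]|/eqP xyE].
  move: xS yS; rewrite !inE !negb_or ![a == _]eq_sym.
  by move=> /andP[/negbTE -> _] /andP[/negbTE -> _].
by have := card_setTD1 4 a; rewrite -xyE cards2 xy.
Qed.

Section Three.

Let F3 : {set {set 'I_3}} := [set S : {set 'I_3} | (1 < #|S|)%N].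

Lemma triangle3E : triangle3 3 = F3.
Proof.
apply/setP => S; have [v sv <-] := bitset_onto 3 S.
have bitE u w : size u = 3%N -> size w = 3%N -> (bitset 3 u == bitset 3 w) = (u == w).
  move=> su sw; apply/eqP/eqP => [E|->] //.
  apply: (@eq_from_nth _ false) => [|i]; rewrite su ?sw // => i3.
  by have := congr1 (fun T : {set 'I_3} => Ordinal i3 \in T) E; rewrite !inE.
have lab s : labelled 3 s = bitset 3 [seq i.+1 \in s | i <- iota 0 3].
  by apply/setP => i; rewrite !inE (nth_map 0%N) ?size_iota // nth_iota.
rewrite /triangle3 !lab !inE !bitE // card_bitset //.
by case: v sv => [|[] [|[] [|[] []]]].
Qed.

(** Two sets of size at least two on three points always meet, so [F3] is intersecting and cannot
    exceed a subfamily that takes one set of each complementary pair. *)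
Lemma maximal_three (F : {set {set 'I_3}}) : intersecting F -> F \subset F3 ->
  (forall S, (S \in F) || (~: S \in F)) -> F3 = F.
Proof.
move=> FI FF3 half; apply: intersecting_eq_half half => //.
apply/intersectingP; split=> [S|S T]; rewrite !inE -card_gt0; first by lia.
have : (#|S :|: T| <= 3)%N by rewrite -[leqRHS](card_ord 3) max_card.
have := cardsUI S T; lia.
Qed.

End Three.

(** * The value of the maximum, and maximality of the maximisers *)

Section Maximum.
Variables (R : realType) (n : nat) (p : R).
Hypotheses (hn : (3 <= n)%N) (hp0 : 0 < p) (hp : p <= 1 / 2).

Let bound : R := p - p * (1 - p) ^+ (n - 1) + (1 - p) * p ^+ (n - 1).

Let p_lt1 : p < 1.
Proof. by move: hp hp0; lra. Qed.

Lemma maximal_le_bound (F : {set {set 'I_n}}) :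
  maximal_intersecting F -> ker F == set0 -> mu p F <= bound.
Proof.
rewrite /bound; case: n hn F => // m m2 F Fmax kF; rewrite subSS subn0.
exact: maximal_bound.
Qed.

Lemma M2_bound : M2 n p = bound.
Proof.
have n0 : (0 < n)%N by case: (n) hn.
apply/le_anti/andP; split; last first.
  rewrite /bound -(mu_one_flip_star R p n (Ordinal n0)).
  by apply: le_bigmax_cond; apply: nontrivial_one_flip.
apply: bigmax_le => [|F Fnt].
  (* The default value 0 of the maximum must also lie below the bound; it does, since the bound is
     the measure of a one-flip star. *)
  by rewrite /bound -(mu_one_flip_star R p n (Ordinal n0)) mu_ge0.
have [C [Cmax kC FC]] := nontrivial_extend _ _ Fnt.
by apply: le_trans (maximal_le_bound C Cmax kC); apply: mu_le.
Qed.

Lemma maximiserP (F : {set {set 'I_n}}) :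
  reflect (nontrivial_intersecting F /\ mu p F = bound) (F \in maximisers n p).
Proof.
by rewrite inE M2_bound; apply: (iffP andP) => -[? /eqP].
Qed.

(** All weights are positive, so a proper extension to a maximal family would exceed the bound. *)
Lemma maximiser_maximal (F : {set {set 'I_n}}) :
  F \in maximisers n p -> maximal_intersecting F /\ ker F == set0.
Proof.
case/maximiserP => Fnt muF.
have [C [Cmax kC FC]] := nontrivial_extend _ _ Fnt.
have [E|FnC] := eqVneq F C; first by rewrite E.
have : F \proper C by rewrite properEneq FnC.
move/(mu_lt R p hp0 p_lt1) => /lt_le_trans /(_ (maximal_le_bound C Cmax kC)).
by rewrite muF ltxx.
Qed.

Lemma one_flip_star_maximiser a : one_flip_star a \in maximisers n p.
Proof.
by apply/maximiserP; rewrite mu_one_flip_star nontrivial_one_flip.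
Qed.

End Maximum.

Theorem theorem1p2 (R : realType) (n : nat) (p : R)
    (hn : (3 <= n)%N) (hp0 : 0 < p) (hp : p <= 1 / 2) :
  [/\ (* value of the maximum, attained by the one-flip stars *)
      M2 n p = p - p * (1 - p) ^+ (n - 1) + (1 - p) * p ^+ (n - 1)
      /\ (forall a : 'I_n, nontrivial_intersecting (one_flip_star a)
                           /\ mu p (one_flip_star a) = M2 n p),
      p < 1 / 2 ->
      [/\ (5 <= n)%N ->
            maximisers n p = [set one_flip_star a | a : 'I_n]
            /\ injective (@one_flip_star n),
          n = 4%N ->
            maximisers n p =
              [set one_flip_star a | a : 'I_n]
              :|: [set triangle_system B | B in ksubsets [set: 'I_n] 3]
            /\ #|maximisers n p| = 8%N
        & n = 3%N ->
            maximisers n p = [set triangle3 n]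
            /\ (forall a : 'I_n, one_flip_star a = triangle3 n)]
    & p = 1 / 2 ->
      M2 n p = 1 / 2
      /\ maximisers n p =
           [set F : {set {set 'I_n}} | maximal_intersecting F && (ker F == set0)]].
Proof.
have p_lt1 : p < 1 by lra.
split.
- split; first exact: M2_bound.
  by move=> a; rewrite mu_one_flip_star M2_bound // nontrivial_one_flip.
- move=> p2; split.
  + move=> n5; split; last by apply: one_flip_star_inj; apply: ltnW.
    apply/setP => F; apply/idP/imsetP => [Fm|[a _ ->]]; last first.
      exact: one_flip_star_maximiser.
    have [Fmax kF] := maximiser_maximal R n p hn hp0 hp F Fm.
    have [_ muF] := maximiserP R n p hn hp0 hp F Fm.
    (* The trace lives on m = n - 1 >= 4 points, the range in which equality forces a one-flip
       star. *)
    case: n hn n5 F {Fm} Fmax kF muF => // m m2 m4 F Fmax kF.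
    rewrite subSS subn0 => muF.
    by have [a ->] := maximal_equality R p hp0 m F m2 Fmax kF p2 m4 muF; exists a.
  + move=> n4; subst n.
    have maxE : maximisers 4 p = [set one_flip_star a | a : 'I_4]
              :|: [set triangle_system B | B in ksubsets [set: 'I_4] 3].
      apply/setP => F; apply/idP/setUP => [Fm|[/imsetP[a _ ->]|/imsetP[B]]].
      * have [Fmax kF] := maximiser_maximal R 4 p hn hp0 hp F Fm.
        have [[a ->]|[d ->]] := maximal_four F Fmax kF; [left|right].
          exact: imset_f.
        by apply: imset_f; rewrite inE subsetT cardsC1 card_ord.
      * exact: one_flip_star_maximiser.
      rewrite inE => /andP[_ /eqP /card3_I4[d ->]] ->.
      by apply/maximiserP; rewrite ?nontrivial_triangle ?mu_triangle_system4.
    split=> //; rewrite maxE cardsU.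
    (* The two kinds are disjoint and each injectively parametrised, which gives 4 + 4 = 8. *)
    have -> : [set one_flip_star a | a : 'I_4]
        :&: [set triangle_system B | B in ksubsets [set: 'I_4] 3] = set0.
      apply/setP => F; rewrite !inE; apply/andP => -[/imsetP[a _ ->] /imsetP[B]].
      rewrite inE => /andP[_ /eqP /card3_I4[d ->]] /eqP.
      by rewrite (negbTE (one_flip_star_neq_triangle_system a d)).
    rewrite cards0 subn0 card_imset; last exact: one_flip_star_inj.
    rewrite card_in_imset ?cards_draws ?cardsT ?card_ord //.
    move=> B C; rewrite !inE => /andP[_ /eqP /card3_I4[d ->]].
    by move=> /andP[_ /eqP /card3_I4[e ->]] /triangle_system_inj4 ->.
  move=> n3; subst n; rewrite triangle3E.
  have flipE (a : 'I_3) : one_flip_star a = [set S : {set 'I_3} | (1 < #|S|)%N].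
    apply/esym/maximal_three; last exact: one_flip_half.
      by case/andP: (nontrivial_one_flip 3 a isT).
    apply/subsetP => S SF; rewrite inE.
    exact: nontrivial_card (nontrivial_one_flip 3 a isT) SF.
  split=> //; apply/setP => F; rewrite [RHS]inE; apply/idP/eqP => [Fm|->]; last first.
    by rewrite -(flipE ord0); apply: one_flip_star_maximiser.
  have [Fmax kF] := maximiser_maximal R 3 p hn hp0 hp F Fm.
  have [Fnt _] := maximiserP R 3 p hn hp0 hp F Fm.
  apply/esym/maximal_three; first exact: maxsetp Fmax.
    by apply/subsetP => S SF; rewrite inE (nontrivial_card _ _ _ Fnt SF).
  by move=> S; rewrite maximal_setC // orbN.
move=> p2.
have M2E : M2 n p = 1 / 2.
  rewrite M2_bound //; have -> : 1 - p = p by lra.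
  by rewrite subrK.
split=> //; apply/setP => F; rewrite [RHS]inE; apply/idP/andP.
  exact: maximiser_maximal.
case=> Fmax kF; rewrite inE M2E /nontrivial_intersecting kF (maxsetp Fmax) /=.
(* At p = q the excess of every trace is zero, so every maximal family has measure 1/2. *)
apply/eqP; case: n {M2E} hn F Fmax kF => // m _ F Fmax _.
exact: maximal_half.
Qed.
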